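(* Let $f:\mathbb{R}^n\to(-\infty,+\infty]$ be proper, lower semicontinuous and prox-bounded with threshold $\lambda_f>0$, and suppose $f$ is prox-regular at $\bar x$ for $\bar v\in\partial f(\bar x)$. Then there exists $0<\bar\lambda\le\lambda_f$ such that for every $0<\lambda<\bar\lambda$ one has $P_\lambda f(\bar x+\lambda\bar v)=\{\bar x\}$, and there exists (for each such $\lambda$) an open convex neighborhood $U_\lambda$ of $\bar x+\lambda\bar v$ such that, with $W_\lambda:=\{(x,v)\in\mathbb{R}^n\times\mathbb{R}^n:\ x+\lambda v\in U_\lambda\}$, the following properties are equivalent: (a) $f$ is variationally convex at $\bar x$ for $\bar v$; (b) for all $0<\lambda<\bar\lambda$, $\partial_p^\lambda f$ is monotone relative to $W_\lambda$; (c) for all $0<\lambda<\bar\lambda$, $\partial_p^\lambda f$ is maximally monotone relative to $W_\lambda$; (d) for all $0<\lambda<\bar\lambda$, $P_\lambda f$ is firmly nonexpansive on $U_\lambda$; (e) for all $0<\lambda<\bar\lambda$ there is $0<\alpha<1$ such that $P_\lambda f$ is $\alpha$-averaged on $U_\lambda$; (f) for all $0<\lambda<\bar\lambda$, $P_\lambda f$ is nonexpansive on $U_\lambda$; (g) for all $0<\lambda<\bar\lambda$, $e_\lambda f$ is convex on $U_\lambda$; (h) there exists $0<\lambda<\bar\lambda$ such that $e_\lambda f$ is convex on $U_\lambda$; (i) for all $0<\lambda<\bar\lambda$, $\nabla e_\lambda f$ is $\lambda$-cocoercive on $U_\lambda$.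
   Context: $j:=\frac12\|\cdot\|^2$. For $\lambda>0$: $e_\lambda f(x):=\inf_{y}\{f(y)+\frac1{2\lambda}\|y-x\|^2\}$ (Moreau envelope) and $P_\lambda f(x):=\operatorname{argmin}_y\{f(y)+\frac1{2\lambda}\|y-x\|^2\}$ (set-valued proximal mapping). $f$ is prox-bounded if $e_\lambda f(x)>-\infty$ for some $\lambda>0$ and some $x$; the threshold $\lambda_f$ is the supremum of all such $\lambda$. The $\lambda$-level proximal subdifferential: for $x\in\operatorname{dom} f$, $v\in\partial_p^\lambda f(x)$ iff $f(y)\ge f(x)+\langle v,y-x\rangle-\frac1{2\lambda}\|y-x\|^2$ for all $y\in\mathbb{R}^n$; $\partial_p^\lambda f(x)=\varnothing$ if $x\notin\operatorname{dom}f$. $\partial f$ is the limiting (Mordukhovich) subdifferential. $f$ is prox-regular at $\bar x$ for $\bar v\in\partial f(\bar x)$ if there are $\varepsilon>0,\rho\ge0$ with $f(y)\ge f(x)+\langle v,y-x\rangle-\frac\rho2\|y-x\|^2$ for all $y\in\mathbb B_\varepsilon(\bar x)$ whenever $v\in\partial f(x)$, $\|v-\bar v\|<\varepsilon$, $\|x-\bar x\|<\varepsilon$, $f(x)<f(\bar x)+\varepsilon$. $f$ is variationally convex at $\bar x$ for $\bar v\in\partial f(\bar x)$ if for some convex neighborhood $U\times V$ of $(\bar x,\bar v)$ there are a lsc convex function $\varphi\le f$ on $U$ and $\varepsilon>0$ such that $[U_\varepsilon\times V]\cap\operatorname{gph}\partial f=[U\times V]\cap\operatorname{gph}\partial\varphi$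 and $f(x)=\varphi(x)$ at the common elements $(x,v)$, where $U_\varepsilon=\{x\in U: f(x)<f(\bar x)+\varepsilon\}$. A set-valued $A$ is monotone relative to $W\subseteq\mathbb{R}^n\times\mathbb{R}^n$ if $\langle x_1-x_2,v_1-v_2\rangle\ge0$ for all $(x_i,v_i)\in\operatorname{gph}A\cap W$; it is maximally monotone relative to $W$ if no $A'$ monotone relative to $W$ has $\operatorname{gph}A'\cap W$ strictly containing $\operatorname{gph}A\cap W$. On a set $U$: $T$ firmly nonexpansive means $\|Tx-Ty\|^2\le\langle x-y,Tx-Ty\rangle$; $\lambda$-cocoercive means $\lambda T$ firmly nonexpansive; $\alpha$-averaged means $T=(1-\alpha)\mathrm{Id}+\alpha N$ with $N$ nonexpansive on $U$. *)

(* Defs.v *)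
From HB Require Import structures.
From mathcomp Require Import all_boot all_order all_algebra.
From mathcomp Require Import boolp classical_sets reals constructive_ereal ereal.

Set Implicit Arguments.
Unset Strict Implicit.
Unset Printing Implicit Defensive.

Import Order.TTheory GRing.Theory Num.Theory.
Local Open Scope classical_set_scope.
Local Open Scope ring_scope.

Section Defs.
Variables (R : realType) (n : nat).

Notation vec := 'rV[R]_n.

Definition dot (x y : vec) : R := \sum_(i < n) x ord0 i * y ord0 i.
Definition nrm2 (x : vec) : R := dot x x.
Definition nrm (x : vec) : R := Num.sqrt (nrm2 x).

Definition is_open (U : set vec) : Prop :=
  forall x, U x -> exists r : R, 0 < r /\ forall y, nrm (y - x) < r -> U y.
Definition is_convex_set (U : set vec) : Prop :=
  forall x y (t : R), U x -> U y -> 0 < t < 1 -> U (t *: x + (1 - t) *: y).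
Definition is_nbhd (U : set vec) (x : vec) : Prop :=
  exists r : R, 0 < r /\ forall y, nrm (y - x) < r -> U y.

Definition proper_fun (f : vec -> \bar R) : Prop :=
  (forall x, f x != -oo%E) /\ exists x, f x != +oo%E.
Definition lsc_fun (f : vec -> \bar R) : Prop :=
  forall x (t : R), (t%:E < f x)%E ->
    exists d : R, 0 < d /\ forall y, nrm (y - x) < d -> (t%:E < f y)%E.
Definition convex_on (U : set vec) (g : vec -> \bar R) : Prop :=
  forall x y (t : R), U x -> U y -> 0 < t < 1 ->
    (g (t *: x + (1 - t) *: y)%R <= t%:E * g x + (1 - t)%:E * g y)%E.

Definition moreau (f : vec -> \bar R) (lam : R) (x : vec) : \bar R :=
  ereal_inf [set (f y + ((2 * lam)^-1 * nrm2 (y - x))%:E)%E | y in [set: vec]].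
Definition prox (f : vec -> \bar R) (lam : R) (x : vec) : set vec :=
  [set y | forall z, (f y + ((2 * lam)^-1 * nrm2 (y - x))%:E
                      <= f z + ((2 * lam)^-1 * nrm2 (z - x))%:E)%E].

Definition prox_bounded (f : vec -> \bar R) : Prop :=
  exists lam : R, 0 < lam /\ exists x, (-oo < moreau f lam x)%E.
Definition prox_threshold (f : vec -> \bar R) : \bar R :=
  ereal_sup [set lam%:E | lam in [set lam : R | 0 < lam /\
                                   exists x, (-oo < moreau f lam x)%E]].

Definition frechet_subdiff (f : vec -> \bar R) (x : vec) : set vec :=
  [set v | f x \is a fin_num /\
     forall e : R, 0 < e -> exists d : R, 0 < d /\
       forall y, nrm (y - x) < d ->
         (f x + (dot v (y - x) - e * nrm (y - x))%:E <= f y)%E].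

Definition limiting_subdiff (f : vec -> \bar R) (x : vec) : set vec :=
  [set v | f x \is a fin_num /\
     exists (xs vs : nat -> vec),
       (forall k, frechet_subdiff f (xs k) (vs k)) /\
       (forall e : R, 0 < e -> exists N, forall k, (N <= k)%N ->
           nrm (xs k - x) < e /\ nrm (vs k - v) < e /\
           ((fine (f x) - e)%:E < f (xs k))%E /\
           (f (xs k) < (fine (f x) + e)%:E)%E)].

Definition lprox_subdiff (f : vec -> \bar R) (lam : R) (x : vec) : set vec :=
  [set v | (f x < +oo)%E /\
     forall y, (f x + (dot v (y - x) - (2 * lam)^-1 * nrm2 (y - x))%:E
                <= f y)%E].

Definition prox_regular (f : vec -> \bar R) (xb vb : vec) : Prop :=
  exists (eps rho : R), 0 < eps /\ 0 <= rho /\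
    forall x v, limiting_subdiff f x v -> nrm (v - vb) < eps ->
      nrm (x - xb) < eps -> (f x < f xb + eps%:E)%E ->
      forall y, nrm (y - xb) < eps ->
        (f x + (dot v (y - x) - rho / 2 * nrm2 (y - x))%:E <= f y)%E.

Definition variationally_convex (f : vec -> \bar R) (xb vb : vec) : Prop :=
  exists (U V : set vec) (phi : vec -> \bar R) (eps : R),
    is_convex_set U /\ is_convex_set V /\ is_nbhd U xb /\ is_nbhd V vb /\
    (forall x, phi x != -oo%E) /\ lsc_fun phi /\ convex_on [set: vec] phi /\
    (forall x, U x -> (phi x <= f x)%E) /\ 0 < eps /\
    forall x v,
      ((U x /\ (f x < f xb + eps%:E)%E) /\ V v /\ limiting_subdiff f x v <->
       U x /\ V v /\ limiting_subdiff phi x v) /\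
      ((U x /\ (f x < f xb + eps%:E)%E) /\ V v /\ limiting_subdiff f x v ->
       f x = phi x).

Definition monotone_rel (A : vec -> set vec) (W : set (vec * vec)) : Prop :=
  forall x1 v1 x2 v2, A x1 v1 -> A x2 v2 -> W (x1, v1) -> W (x2, v2) ->
    0 <= dot (x1 - x2) (v1 - v2).
Definition max_monotone_rel (A : vec -> set vec) (W : set (vec * vec)) : Prop :=
  monotone_rel A W /\
  forall A' : vec -> set vec, monotone_rel A' W ->
    (forall x v, A x v -> W (x, v) -> A' x v) ->
    (forall x v, A' x v -> W (x, v) -> A x v).

Definition firmly_nonexp_on (T : vec -> set vec) (U : set vec) : Prop :=
  forall x y p q, U x -> U y -> T x p -> T y q ->
    nrm2 (p - q) <= dot (x - y) (p - q).
Definition nonexp_on (T : vec -> set vec) (U : set vec) : Prop :=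
  forall x y p q, U x -> U y -> T x p -> T y q -> nrm (p - q) <= nrm (x - y).
Definition averaged_on (alpha : R) (T : vec -> set vec) (U : set vec) : Prop :=
  exists N : vec -> vec,
    (forall x y, U x -> U y -> nrm (N x - N y) <= nrm (x - y)) /\
    forall x, U x -> T x = [set (1 - alpha) *: x + alpha *: N x].

Definition gradient_on (h : vec -> \bar R) (g : vec -> vec) (U : set vec) : Prop :=
  forall x, U x -> h x \is a fin_num /\
    forall e : R, 0 < e -> exists d : R, 0 < d /\
      forall y, nrm (y - x) < d -> h y \is a fin_num /\
        `|fine (h y) - fine (h x) - dot (g x) (y - x)| <= e * nrm (y - x).
(* lam-cocoercive: lam * g firmly nonexpansive on U *)
Definition cocoercive_on (lam : R) (g : vec -> vec) (U : set vec) : Prop :=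
  forall x y, U x -> U y ->
    nrm2 (lam *: g x - lam *: g y) <= dot (x - y) (lam *: g x - lam *: g y).

End Defs.

Definition Wset (R : realType) (n : nat) (U : set 'rV[R]_n) (lam : R)
  : set ('rV[R]_n * 'rV[R]_n) :=
  [set xv | U (xv.1 + lam *: xv.2)].

(* Main.v *)
Require Import Defs.
From HB Require Import structures.
From mathcomp Require Import all_boot all_order all_algebra ring lra.
From mathcomp Require Import boolp classical_sets reals constructive_ereal ereal.
From mathcomp Require Import topology normedtype.
Import Order.TTheory GRing.Theory Num.Theory numFieldNormedType.Exports.
Local Open Scope classical_set_scope.
Local Open Scope ring_scope.

(** Prox-regularity and prox-boundedness give a global quadratic minorant of [f] at [xb]
    with slope [vb] and curvature [1/lam1].  Hence for [lam < lam1] the proximal mapping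
    is nonempty, equals [{xb}] at [ub = xb + lam vb], and near [ub] its values [p] are
    close to [xb] in the [f]-attentive sense, with slopes [(u - p)/lam] close to [vb].

    Two implications involve variational convexity.  If it holds, then near [ub] the graph
    of the [lam]-proximal subdifferential of [f] lies in the graph of the subdifferential
    of a convex function, so it is monotone, which amounts to firm nonexpansiveness of
    [prox f lam].  Conversely, if [e_lam f] is convex on some neighborhood of [ub], let [phi] be the supremum of the affine functions
    [f p + <v, . - p>] with [p] in [prox f lam u], [v = (u - p)/lam] and [u] near [ub];
    comparing [e_lam f] at [u] and at [y + lam v] gives [phi <= f] near [xb],
    prox-regularity shows that all nearby subgradients of [f] occur among these slopes, and
    a Minty argument shows that [phi] has no others.  The remaining equivalences hold for
    each [lam] separately, on any open convex set.

    Since the second implication works on any neighborhood, [U lam] only has to be small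
    when [f] is variationally convex, and it is chosen with this knowledge. *)

(** * Euclidean inner product, norm and balls on row vectors *)

Section Euclidean.
Set Implicit Arguments.
Unset Strict Implicit.
Variables (R : realType) (n : nat).
Implicit Types (x y z : 'rV[R]_n) (a : R).

Lemma dotC x y : dot x y = dot y x.
Proof. by apply: eq_bigr => i _; rewrite mulrC. Qed.

Lemma dotDl x y z : dot (x + y) z = dot x z + dot y z.
Proof. by rewrite /dot -big_split; apply: eq_bigr => i _; rewrite mxE mulrDl. Qed.

Lemma dotZl a x y : dot (a *: x) y = a * dot x y.
Proof. by rewrite /dot mulr_sumr; apply: eq_bigr => i _; rewrite mxE mulrA. Qed.

Lemma dotDr x y z : dot z (x + y) = dot z x + dot z y.
Proof. by rewrite dotC dotDl !(dotC z). Qed.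

Lemma dotZr a x y : dot x (a *: y) = a * dot x y.
Proof. by rewrite dotC dotZl (dotC x). Qed.

Lemma dotNl x y : dot (- x) y = - dot x y.
Proof. by rewrite -scaleN1r dotZl mulN1r. Qed.

Lemma dotNr x y : dot x (- y) = - dot x y.
Proof. by rewrite dotC dotNl (dotC x). Qed.

Definition dotE := (dotDl, dotDr, dotNl, dotNr, dotZl, dotZr).

Lemma dot0r x : dot x 0 = 0.
Proof. by rewrite -(scale0r 0) dotZr mul0r. Qed.

Lemma nrm2D x y : nrm2 (x + y) = nrm2 x + 2 * dot x y + nrm2 y.
Proof. by rewrite /nrm2 !dotE (dotC y x); ring. Qed.

Lemma nrm2B x y : nrm2 (x - y) = nrm2 x - 2 * dot x y + nrm2 y.
Proof. by rewrite /nrm2 !dotE (dotC y x); ring. Qed.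

Lemma nrm2N x : nrm2 (- x) = nrm2 x.
Proof. by rewrite /nrm2 !dotE opprK. Qed.

Lemma nrm2Z a x : nrm2 (a *: x) = a ^+ 2 * nrm2 x.
Proof. by rewrite /nrm2 !dotE; ring. Qed.

Lemma nrm2_ge0 x : 0 <= nrm2 x.
Proof. by apply: sumr_ge0 => i _; rewrite -expr2 sqr_ge0. Qed.

Lemma nrm2_eq0 x : nrm2 x = 0 -> x = 0.
Proof.
move=> /eqP; rewrite psumr_eq0; last by move=> i _; rewrite -expr2 sqr_ge0.
move=> /allP h; apply/rowP => i; rewrite mxE; apply/eqP.
by have := h i (mem_index_enum i); rewrite -expr2 sqrf_eq0.
Qed.

Lemma nrm_ge0 x : 0 <= nrm x.
Proof. exact: sqrtr_ge0. Qed.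

Lemma nrm2E x : nrm2 x = nrm x ^+ 2.
Proof. by rewrite sqr_sqrtr // nrm2_ge0. Qed.

Lemma nrm0 : nrm (0 : 'rV[R]_n) = 0.
Proof. by rewrite /nrm /nrm2 dot0r sqrtr0. Qed.

Lemma nrmN x : nrm (- x) = nrm x.
Proof. by rewrite /nrm nrm2N. Qed.

Lemma nrmZ a x : nrm (a *: x) = `|a| * nrm x.
Proof.
by rewrite /nrm nrm2Z sqrtrM ?sqr_ge0 // sqrtr_sqr.
Qed.

(** Cauchy-Schwarz: expand the square of [nrm y *: x - nrm x *: y] and divide by [nrm x * nrm y],
    the zero cases being treated apart. *)
Lemma dot_le_nrm x y : dot x y <= nrm x * nrm y.
Proof.
have [x0|x0] := eqVneq (nrm x) 0.
  have /nrm2_eq0 -> : nrm2 x = 0 by rewrite nrm2E x0 expr0n.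
  by rewrite dotC dot0r nrm0 mul0r.
have [y0|y0] := eqVneq (nrm y) 0.
  have /nrm2_eq0 -> : nrm2 y = 0 by rewrite nrm2E y0 expr0n.
  by rewrite dot0r nrm0 mulr0.
have xp : 0 < nrm x by rewrite lt_def x0 nrm_ge0.
have yp : 0 < nrm y by rewrite lt_def y0 nrm_ge0.
have := nrm2_ge0 (nrm y *: x - nrm x *: y).
rewrite nrm2B !nrm2Z !dotE !nrm2E.
have xy : 0 < nrm x * nrm y by rewrite mulr_gt0.
by move=> h; rewrite -(ler_pM2l xy); nra.
Qed.

Lemma ler_nrmD x y : nrm (x + y) <= nrm x + nrm y.
Proof.
rewrite -(@ler_pXn2r _ 2) ?nnegrE ?addr_ge0 ?nrm_ge0 //.
rewrite -nrm2E nrm2D !nrm2E.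
by have := dot_le_nrm x y; nra.
Qed.

Lemma ler_nrmB x y : nrm (x - y) <= nrm x + nrm y.
Proof. by rewrite (le_trans (ler_nrmD _ _)) ?nrmN. Qed.

Lemma dot_geN_nrm x y : - (nrm x * nrm y) <= dot x y.
Proof. by have := dot_le_nrm (- x) y; rewrite dotNl nrmN; lra. Qed.

Lemma nrm_entry x i : `|x ord0 i| <= nrm x.
Proof.
rewrite -(@ler_pXn2r _ 2) ?nnegrE ?nrm_ge0 // -nrm2E real_normK ?num_real //.
rewrite /nrm2 /dot (bigD1 i) //= -expr2 lerDl.
by apply: sumr_ge0 => j _; rewrite -expr2 sqr_ge0.
Qed.

Definition oball x (r : R) : set 'rV[R]_n := [set y | nrm (y - x) < r].

Lemma oball_center x r : 0 < r -> oball x r x.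
Proof. by rewrite /oball /= subrr nrm0. Qed.

Lemma oball_open x r : is_open (oball x r).
Proof.
move=> y yr; exists (r - nrm (y - x)); split; first by rewrite subr_gt0.
move=> z zr; rewrite /oball /= -(subrK y z) -addrA.
by rewrite (le_lt_trans (ler_nrmD _ _)) // -ltrBrDr.
Qed.

Lemma oball_convex x r : is_convex_set (oball x r).
Proof.
move=> y z t yr zr /andP[t0 t1]; rewrite /oball /=.
have -> : t *: y + (1 - t) *: z - x = t *: (y - x) + (1 - t) *: (z - x).
  by apply/rowP => i; rewrite !mxE; ring.
have t1' : 0 < 1 - t by rewrite subr_gt0.
apply: le_lt_trans (ler_nrmD _ _) _; rewrite !nrmZ !gtr0_norm //.
by have := @ltr_pM2l _ _ t0 (nrm (y - x)) r; have := @ltr_pM2l _ _ t1' (nrm (z - x)) r;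
  move: yr zr; rewrite /oball /= => -> -> ? ?; lra.
Qed.

Lemma oball_nbhd x r : 0 < r -> is_nbhd (oball x r) x.
Proof. by move=> r0; exists r. Qed.

(* The library topology on row vectors is that of the sup norm, whereas [nrm] is the
   Euclidean norm. *)
Lemma nbhs_oball x r : 0 < r -> nbhs x (oball x r).
Proof.
move=> r0.
have e0 : 0 < r / n.+1%:R by rewrite divr_gt0 // ltr0n.
apply/nbhs_ballP; exists (r / n.+1%:R) => //= y [_ xy].
rewrite /oball /= -(@ltr_pXn2r _ 2) ?nnegrE ?nrm_ge0 ?ltW // -nrm2E.
apply: (@le_lt_trans _ _ (\sum_(i < n) (r / n.+1%:R) ^+ 2)).
  apply: ler_sum => i _; have := xy ord0 i.
  rewrite /ball /= !mxE -expr2 distrC => h.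
  by rewrite -real_normK ?num_real // ler_pXn2r ?nnegrE // ltW.
rewrite sumr_const card_ord -[ltLHS]mulr_natr expr_div_n -mulrA gtr_pMr ?exprn_gt0 //.
rewrite mulrC ltr_pdivrMr ?exprn_gt0 ?ltr0n // mul1r -natrX ltr_nat.
by rewrite expnS expn1 leq_pmulr.
Qed.

End Euclidean.

(** * Global quadratic minorants *)

Section Growth.
Set Implicit Arguments.
Unset Strict Implicit.
Variables (R : realType) (n : nat).
Implicit Types (f : 'rV[R]_n -> \bar R) (x y : 'rV[R]_n).

Lemma moreau_le f lam x y :
  (moreau f lam x <= f y + ((2 * lam)^-1 * nrm2 (y - x))%:E)%E.
Proof. by apply: ereal_inf_lbound; exists y. Qed.

(** The infimum defining the envelope at [x] bounds every [f y] from below, so one envelope value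
    above [-oo] suffices. *)
Lemma prox_bounded_minorant f : prox_bounded f ->
  exists (lam : R) (x : 'rV[R]_n) (c : R),
    [/\ 0 < lam, (lam%:E <= prox_threshold f)%E &
        forall y, ((c - (2 * lam)^-1 * nrm2 (y - x))%:E <= f y)%E].
Proof.
move=> [lam [lam0 [x xm]]]; exists lam, x.
have [c cm] : exists c : R, (c%:E <= moreau f lam x)%E.
  by case: (moreau f lam x) xm => // [m _|_]; [exists m | exists 0; rewrite leey].
exists c; split=> //.
  by apply: ereal_sup_ubound; exists lam => //; split=> //; exists x.
move=> y; have := le_trans cm (moreau_le f lam x y).
by case: (f y) => [b| |] //; rewrite ?leey // -EFinD !lee_fin; lra.
Qed.

Lemma limiting_fin f x v : limiting_subdiff f x v -> exists a : R, f x = a%:E.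
Proof. by move=> [/fineK <- _]; exists (fine (f x)). Qed.

(** Within [eps] of [xb], prox-regularity gives the minorant. Farther away the one from
    prox-boundedness does, once the curvature is enlarged, since terms of lower order are there at
    most a multiple of [nrm2 (y - xb)]. The same curvature serves in the prox-regular inequality. *)
Lemma prox_regular_growth f xb vb a :
  prox_bounded f -> limiting_subdiff f xb vb -> prox_regular f xb vb ->
  f xb = a%:E ->
  exists lam eps : R,
    [/\ 0 < lam, (lam%:E <= prox_threshold f)%E, 0 < eps,
     forall y, ((a + dot vb (y - xb) - (2 * lam)^-1 * nrm2 (y - xb))%:E <= f y)%E &
     forall x v, limiting_subdiff f x v -> nrm (v - vb) < eps ->
       nrm (x - xb) < eps -> (f x < (a + eps)%:E)%E ->
       forall y, nrm (y - xb) < eps ->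
         (f x + (dot v (y - x) - (2 * lam)^-1 * nrm2 (y - x))%:E <= f y)%E].
Proof.
move=> /prox_bounded_minorant [lam0 [x0 [c [lam0_gt0 lam0_le fc]]]] subd.
move=> [eps [rho [eps0 [rho0 reg]]]] fa.
set k0 := (2 * lam0)^-1.
have k0_gt0 : 0 < k0 by rewrite invr_gt0; lra.
(* The factor 2 pays for the cross term of [nrm2 (y - x0)]. In [M] there is one summand per error:
   the change of centre from [x0] to [xb], the slope [vb], the constant [K], and the prox-regularity
   modulus. *)
set K : R := `|a - c + 2 * k0 * nrm2 (xb - x0)|.
set M := k0 + nrm vb / eps + K / eps ^+ 2 + rho / 2.
have h1 : 0 <= nrm vb / eps by rewrite divr_ge0 ?nrm_ge0 // ltW.
have h2 : 0 <= K / eps ^+ 2 by rewrite divr_ge0 ?normr_ge0 ?exprn_ge0 ?ltW.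
have M_gt0 : 0 < M by rewrite /M; lra.
exists (2 * (k0 + M))^-1, eps.
have kM : 0 < 2 * (k0 + M) by lra.
have -> : (2 * (2 * (k0 + M))^-1)^-1 = k0 + M.
  by rewrite invfM invrK mulrA mulVf ?mul1r // pnatr_eq0.
have rhoM : rho / 2 <= k0 + M by rewrite /M; lra.
have reg' x v : limiting_subdiff f x v -> nrm (v - vb) < eps ->
    nrm (x - xb) < eps -> (f x < (a + eps)%:E)%E ->
    forall y, nrm (y - xb) < eps ->
    (f x + (dot v (y - x) - (k0 + M) * nrm2 (y - x))%:E <= f y)%E.
  move=> fv vv xx fx y yy; apply: le_trans (reg x v fv vv xx _ y yy).
    apply: leeD2l; rewrite lee_fin.
    by have := ler_wpM2r (nrm2_ge0 (y - x)) rhoM; lra.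
  by rewrite fa -EFinD.
split=> //; first by rewrite invr_gt0.
- apply: le_trans lam0_le; rewrite lee_fin.
  rewrite -[leRHS]invrK lef_pV2 ?posrE ?invr_gt0 //.
  have -> : lam0^-1 = 2 * k0 by rewrite /k0 invfM mulrA mulfV ?mul1r // pnatr_eq0.
  by lra.
move=> y; case: (ltP (nrm (y - xb)) eps) => [ye|ye].
  have := reg' xb vb subd; rewrite !subrr nrm0 fa lte_fin ltrDl.
  by move=> /(_ eps0 eps0 eps0 y ye); rewrite -EFinD addrA.
apply: le_trans (fc y); rewrite lee_fin -/k0.
have := nrm2_ge0 ((y - xb) - (xb - x0)).
have -> : y - x0 = (y - xb) + (xb - x0) by rewrite addrA subrK.
move: ye; rewrite /K /M; set d := y - xb; set z := xb - x0 => ye.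
rewrite nrm2B nrm2D => dz.
have dv := dot_le_nrm vb d.
have e1 : nrm vb * nrm d <= nrm vb / eps * nrm2 d.
  rewrite nrm2E expr2 mulrA; apply: ler_wpM2r (nrm_ge0 d) _ _ _.
  rewrite mulrAC ler_pdivlMr //; exact: ler_wpM2l (nrm_ge0 _) _ _ ye.
have e2 : a - c + 2 * k0 * nrm2 z <= K / eps ^+ 2 * nrm2 d.
  apply: le_trans (ler_norm _) _; rewrite -/K mulrAC ler_pdivlMr ?exprn_gt0 //.
  apply: ler_wpM2l; first exact: normr_ge0.
  by rewrite nrm2E ler_pXn2r ?nnegrE ?nrm_ge0 // ltW.
have e3 : 0 <= rho / 2 * nrm2 d by rewrite mulr_ge0 ?nrm2_ge0 //; lra.
have e4 : k0 * (2 * dot d z) <= k0 * (nrm2 d + nrm2 z).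
  by rewrite ler_pM2l //; move: dz; lra.
rewrite /M; lra.
Qed.

End Growth.

(** * Existence of minimizers and lower semicontinuity *)

Section Minimization.
Set Implicit Arguments.
Unset Strict Implicit.
Variables (R : realType) (n : nat).
Implicit Types (f h : 'rV[R]_n -> \bar R) (u x y : 'rV[R]_n).

(** The sublevel sets of [h] in [K] are nested and generate a proper filter. At a cluster point,
    lower semicontinuity excludes a value above any [h y] with [y] in [K]. *)
Lemma lsc_attains_min h (K : set 'rV[R]_n) x0 :
  (forall x, h x != -oo%E) -> lsc_fun h -> compact K -> K x0 ->
  exists x, K x /\ forall y, K y -> (h x <= h y)%E.
Proof.
move=> hN hl Kc K0.
pose B y := [set z | K z /\ (h z <= h y)%E].
pose F : set_system 'rV[R]_n := [set S | exists2 y, K y & B y `<=` S].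
have FF : ProperFilter F.
  split; first by move=> [y Ky] /(_ y); apply; split.
  split; first by exists x0.
    move=> P Q [y Ky yP] [z Kz zQ].
    case: (leP (h y) (h z)) => yz; [exists y | exists z] => //= w [Kw hw].
      by split; [apply: yP | apply: zQ; split=> //; apply: le_trans yz].
    by split; [apply: yP; split=> //; apply: le_trans (ltW yz) | apply: zQ].
  by move=> P Q PQ [y Ky yP]; exists y => //; apply: subset_trans PQ.
have [|x [Kx clx]] := Kc F FF; first by exists x0 => // y [].
exists x; split=> // y Ky; rewrite leNgt; apply/negP => yx.
have [c hc] : exists c : R, h y = c%:E.
  by case: (h y) (hN y) yx => [c| |] //; [exists c | rewrite ltNge leey].
rewrite hc in yx; have [d [d0 hd]] := hl x c yx.
have [z [[Kz zy] xz]] :=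
  clx (B y) _ (ex_intro2 _ _ y Ky (subset_refl (A := B y))) (nbhs_oball x d0).
by move: zy; rewrite hc leNgt hd.
Qed.

(** A product of segments is compact; by [nrm_entry] such a cube contains the Euclidean ball of the
    same radius. *)
Lemma cube_compact (x : 'rV[R]_n) (r : R) :
  compact [set y : 'rV[R]_n | forall i, x ord0 i - r <= y ord0 i <= x ord0 i + r].
Proof.
have := @rV_compact R n (fun i => `[x ord0 i - r, x ord0 i + r]%classic)
  (fun i => @segment_compact R _ _).
by congr compact; apply/seteqP; split=> y /= h i; have := h i; rewrite in_itv.
Qed.

Lemma lsc_add_quad f (k : R) u : 0 <= k -> lsc_fun f ->
  lsc_fun (fun y => f y + (k * nrm2 (y - u))%:E)%E.
Proof.
move=> k0 fl x t tx.
(* The gap between [s] and [t - k * nrm2 (x - u)] pays for the variation of the quadratic term,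
   which falls at most linearly, at rate [c]. *)
have [s ts sx] : exists2 s : R, t - k * nrm2 (x - u) < s & (s%:E < f x)%E.
  case: (f x) tx => [b| |] //; last first.
    by exists (t - k * nrm2 (x - u) + 1); rewrite ?ltry // ltrDl.
  rewrite -EFinD lte_fin => tb.
  by exists ((t - k * nrm2 (x - u) + b) / 2); rewrite ?lte_fin; lra.
have [d [d0 fd]] := fl x s sx.
set q := nrm2 (x - u) in ts *; set c := 2 * k * nrm (x - u) + 1.
have c0 : 0 < c by rewrite /c; have := mulr_ge0 k0 (nrm_ge0 (x - u)); lra.
exists (Num.min d ((s - (t - k * q)) / c)); split.
  by rewrite lt_min d0 divr_gt0 //; lra.
move=> y; rewrite lt_min => /andP[yd yc].
move: yc; rewrite ltr_pdivlMr // => yc.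
have : k * q - nrm (y - x) * c <= k * nrm2 (y - u).
  have -> : y - u = (x - u) + (y - x) by rewrite [RHS]addrC addrA subrK.
  rewrite nrm2D -/q /c.
  have h1 := mulr_ge0 k0 (nrm2_ge0 (y - x)).
  have h2 := ler_wpM2l k0 (dot_geN_nrm (x - u) (y - x)).
  by have h3 := nrm_ge0 (y - x); lra.
have := fd y yd; case: (f y) => [b| |] //; rewrite ?ltry //.
by rewrite -EFinD !lte_fin; lra.
Qed.

Lemma prox_real f lam u p :
  proper_fun f -> prox f lam u p -> exists b : R, f p = b%:E.
Proof.
move=> [fN [x fx]] /(_ x).
case: (f x) (fN x) fx => // a _ _; rewrite -EFinD.
by case: (f p) (fN p) => // b _ _; exists b.
Qed.

End Minimization.

(** * Existence and localization of proximal points *)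

Section ProximalMapping.
Set Implicit Arguments.
Unset Strict Implicit.
Variables (R : realType) (n : nat) (f : 'rV[R]_n -> \bar R) (xb vb : 'rV[R]_n).
Variables (a lam1 lam : R).
Hypothesis fP : proper_fun f.
Hypothesis flsc : lsc_fun f.
Hypothesis fa : f xb = a%:E.
Hypothesis growth :
  forall y, ((a + dot vb (y - xb) - (2 * lam1)^-1 * nrm2 (y - xb))%:E <= f y)%E.
Hypothesis lam_bd : 0 < lam < lam1.

Let k := (2 * lam)^-1.
Let k1 := (2 * lam1)^-1.
Let ub := xb + lam *: vb.

Lemma lam_gt0 : 0 < lam. Proof. by case/andP: lam_bd. Qed.

Lemma k1_gt0 : 0 < k1.
Proof. by case/andP: lam_bd => l0 l1; rewrite invr_gt0; lra. Qed.

Lemma k1_lt : k1 < k.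
Proof.
by case/andP: lam_bd => l0 l1; rewrite ltf_pV2 ?posrE; lra.
Qed.

Lemma k_gt0 : 0 < k. Proof. exact: lt_trans k1_gt0 k1_lt. Qed.

Lemma invlam : lam^-1 = 2 * k.
Proof. by rewrite /k invfM mulrA mulfV ?mul1r // pnatr_eq0. Qed.

Lemma lamk : 2 * k * lam = 1.
Proof. by rewrite -invlam mulVf // gt_eqF // lam_gt0. Qed.

(** Since [2 * k * lam = 1], the linear term of the minorant cancels against the cross term with
    [lam *: vb]. What remains is [(k - k1) |p - xb|^2 <= 2 k <p - xb, u - ub>], and Cauchy-Schwarz
    applies. *)
Lemma growth_near u p b : f p = b%:E ->
  b + k * nrm2 (p - u) <= a + k * nrm2 (xb - u) ->
  (k - k1) * nrm (p - xb) <= 2 * k * nrm (u - ub).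
Proof.
move=> fp; have := growth p; rewrite fp lee_fin -/k1.
have -> : p - u = (p - xb) - (u - ub + lam *: vb).
  by apply/rowP => i; rewrite /ub !mxE; ring.
have -> : xb - u = - (u - ub + lam *: vb).
  by apply/rowP => i; rewrite /ub !mxE; ring.
move: (p - xb) (u - ub) => d e; rewrite nrm2N nrm2B !dotE (dotC d vb) => g h.
have lk : k * (2 * (lam * dot vb d)) = dot vb d.
  by rewrite -[RHS]mul1r -[X in _ = X * _]lamk; ring.
have {h} h : (k - k1) * nrm2 d <= 2 * k * dot d e by move: h lk; lra.
have [->|d0] := eqVneq (nrm d) 0.
  by rewrite mulr0 !mulr_ge0 ?nrm_ge0 // ltW // k_gt0.
have dp : 0 < nrm d by rewrite lt_def d0 nrm_ge0.
rewrite -(ler_pM2r dp); have := ler_wpM2l (ltW k_gt0) (dot_le_nrm d e).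
by move: h; rewrite nrm2E; lra.
Qed.

(** By [growth_near], every point that does at least as well as [xb] lies within [r] of [xb], so
    minimizing over a cube is enough. *)
Lemma prox_exists u : exists p, prox f lam u p.
Proof.
set r := 2 * k * nrm (u - ub) / (k - k1).
have kk : 0 < k - k1 by rewrite subr_gt0 k1_lt.
pose h := fun y => (f y + (k * nrm2 (y - u))%:E)%E.
have hN x : h x != -oo%E by rewrite /h; case: (f x) (fP.1 x).
have hl : lsc_fun h by apply: lsc_add_quad => //; rewrite ltW // k_gt0.
have r0 : 0 <= r.
  by rewrite divr_ge0 ?mulr_ge0 ?nrm_ge0 // ?ltW // k_gt0.
have [|p [_ hp]] := lsc_attains_min (x0 := xb) hN hl (@cube_compact _ n xb r).
  by move=> i; rewrite lerBlDr lerDl r0.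
exists p => z; rewrite -/k -/(h p) -/(h z).
case: (leP (h z) (h xb)) => zx; last first.
  apply: le_trans (ltW zx); apply: hp => i /=.
  by rewrite lerBlDr lerDl r0.
apply: hp => i /=; move: zx; rewrite /h fa -EFinD.
have := fP.1 z; case fz: (f z) => [b| |] // _; rewrite -EFinD lee_fin => hz.
have := growth_near fz hz; rewrite mulrC -ler_pdivlMr // -/r => zr.
have := le_trans (nrm_entry (z - xb) i) zr; rewrite !mxE ler_norml; lra.
Qed.

Lemma prox_near u p : prox f lam u p ->
  (k - k1) * nrm (p - xb) <= 2 * k * nrm (u - ub).
Proof.
move=> pu; have [b fp] := prox_real fP pu; apply: growth_near (fp) _.
by have := pu xb; rewrite fp fa -!EFinD lee_fin.
Qed.

Lemma prox_center : prox f lam ub = [set xb].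
Proof.
have cent p : prox f lam ub p -> p = xb.
  move=> /prox_near; rewrite subrr nrm0 mulr0 pmulr_rle0 ?subr_gt0 ?k1_lt // => h.
  apply/subr0_eq/nrm2_eq0; rewrite nrm2E.
  by have -> : nrm (p - xb) = 0; [apply/eqP; rewrite eq_le h nrm_ge0 | rewrite expr0n].
apply/seteqP; split=> [p /cent //|_ ->].
by have [p pu] := prox_exists ub; rewrite -(cent p pu).
Qed.

Lemma prox_localization (e : R) : 0 < e ->
  exists d : R, 0 < d /\ forall u p, nrm (u - ub) < d -> prox f lam u p ->
    [/\ nrm (p - xb) < e, nrm (lam^-1 *: (u - p) - vb) < e & (f p < (a + e)%:E)%E].
Proof.
move=> e0; have kk : 0 < k - k1 by rewrite subr_gt0 k1_lt.
have k0 := k_gt0; have l0 := lam_gt0.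
set C := 2 * k / (k - k1).
have C0 : 0 <= C by rewrite divr_ge0 ?mulr_ge0 // ltW.
have V0 : 0 <= lam * nrm vb by rewrite mulr_ge0 ?nrm_ge0 // ltW.
have kC : 0 <= k * C by rewrite mulr_ge0 // ltW.
have kCV : 0 <= k * C * (lam * nrm vb) by rewrite mulr_ge0.
(* [D] adds up the factors of [nrm (u - ub)] in the bounds for point, slope and value; the value
   bound, from comparison with [xb], also uses [nrm (u - ub) < 1]. *)
set D := 1 + C + 2 * k * (1 + C) + 2 * (k * C * (1 + lam * nrm vb)).
have D0 : 0 < D by rewrite /D; lra.
exists (Num.min 1 (e / D)); split; first by rewrite lt_min ltr01 divr_gt0.
move=> u p; rewrite lt_min ltr_pdivlMr // => /andP[u1 uD] pu.
have near : nrm (p - xb) <= C * nrm (u - ub).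
  by rewrite /C mulrAC ler_pdivlMr // mulrC; exact: prox_near.
have e_ge := nrm_ge0 (u - ub).
have Ce : 0 <= C * nrm (u - ub) by rewrite mulr_ge0.
have kCe : 0 <= k * C * nrm (u - ub) by rewrite mulr_ge0.
have ke : 0 <= k * nrm (u - ub) by rewrite mulr_ge0 // ltW.
have kVe : 0 <= k * C * (lam * nrm vb) * nrm (u - ub) by rewrite mulr_ge0.
split.
- by move: near uD; rewrite /D; lra.
- have -> : lam^-1 *: (u - p) - vb = lam^-1 *: ((u - ub) - (p - xb)).
    apply/rowP => i; rewrite /ub !mxE; field; exact: lt0r_neq0.
  rewrite nrmZ gtr0_norm ?invr_gt0 // invlam.
  have h1 := ler_wpM2l (ltW k0) (ler_nrmB (u - ub) (p - xb)).
  have h2 := ler_wpM2l (ltW k0) near.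
  by move: uD h1 h2; rewrite /D; lra.
have [b fp] := prox_real fP pu; rewrite fp lte_fin.
have := pu xb; rewrite fp fa -!EFinD lee_fin -/k.
have -> : p - u = (p - xb) - (u - ub + lam *: vb).
  by apply/rowP => i; rewrite /ub !mxE; ring.
have -> : xb - u = - (u - ub + lam *: vb).
  by apply/rowP => i; rewrite /ub !mxE; ring.
rewrite nrm2N nrm2B => h.
have d0 := mulr_ge0 (ltW k0) (nrm2_ge0 (p - xb)).
have := dot_le_nrm (p - xb) (u - ub + lam *: vb).
have : nrm (u - ub + lam *: vb) <= 1 + lam * nrm vb.
  by have := ler_nrmD (u - ub) (lam *: vb); rewrite nrmZ gtr0_norm //; lra.
move=> w1 w2.
have w3 : nrm (p - xb) * nrm (u - ub + lam *: vb)
    <= C * nrm (u - ub) * (1 + lam * nrm vb).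
  by apply: ler_pM; rewrite ?nrm_ge0.
have w4 := ler_wpM2l (ltW k0) (le_trans w2 w3).
by move: uD h; rewrite /D; lra.
Qed.

End ProximalMapping.

(** * Limit passages in real inequalities *)

Section ApproximateInequalities.
Set Implicit Arguments.
Unset Strict Implicit.
Variable R : realType.

Lemma le_dyadic (X Y c : R) : 0 <= c -> (forall j : nat, X <= Y + c / 2 ^+ j) -> X <= Y.
Proof.
move=> c0 h; rewrite leNgt; apply/negP => YX; have d0 : 0 < X - Y by rewrite subr_gt0.
have := archi_boundP (divr_ge0 c0 (ltW d0)); set j := Num.bound _ => cj.
have : c / (X - Y) < 2 ^+ j.
  by apply: lt_trans cj _; rewrite -natrX ltr_nat ltn_expl.
rewrite ltr_pdivrMr // mulrC -ltr_pdivrMr ?exprn_gt0 //.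
by have := h j; lra.
Qed.

Lemma le_small (X Y c t0 : R) : 0 < t0 -> 0 <= c ->
  (forall t, 0 < t < t0 -> X <= Y + t * c) -> X <= Y.
Proof.
move=> t0_gt0 c0 h; rewrite leNgt; apply/negP => YX.
have c1 : 0 < c + 1 by lra.
have d0 : 0 < X - Y by rewrite subr_gt0.
set t := Num.min (t0 / 2) ((X - Y) / (c + 1)).
have tp : 0 < t by rewrite lt_min !divr_gt0.
have tt : t < t0 by rewrite gt_min; apply/orP; left; lra.
have : t <= (X - Y) / (c + 1) by rewrite ge_min lexx orbT.
rewrite ler_pdivlMr // => tc.
by have := h t; rewrite tp tt => /(_ isT); lra.
Qed.

End ApproximateInequalities.

(** * Proximal mapping and Moreau envelope for one fixed [lam] *)

Section MoreauEnvelope.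
Set Implicit Arguments.
Unset Strict Implicit.
Variables (R : realType) (n : nat) (f : 'rV[R]_n -> \bar R) (lam : R).
Hypothesis fP : proper_fun f.
Hypothesis lam0 : 0 < lam.
Hypothesis prox_ex : forall u, exists p, prox f lam u p.
Implicit Types (u w x y z p q v : 'rV[R]_n) (U : set 'rV[R]_n).

Let k := (2 * lam)^-1.
Let E u := fine (moreau f lam u).

Lemma stepk_gt0 : 0 < k. Proof. by rewrite invr_gt0 mulr_gt0. Qed.

Lemma stepkK (c : R) : k * (2 * (lam * c)) = c.
Proof. by rewrite /k; field; exact: lt0r_neq0. Qed.

(** Completing the square: the two inequalities differ by the constant [k * nrm2 (lam *: v)]. Thus
    [prox f lam] is the resolvent of the [lam]-proximal subdifferential. *)
Lemma lprox_proxE x v : lprox_subdiff f lam x v <-> prox f lam (x + lam *: v) x.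
Proof.
have expand z : nrm2 (z - (x + lam *: v)) =
    nrm2 (z - x) - 2 * (lam * dot v (z - x)) + nrm2 (lam *: v).
  have -> : z - (x + lam *: v) = (z - x) - lam *: v by rewrite opprD addrA.
  by rewrite [LHS]nrm2B dotZr (dotC _ v).
have xx : nrm2 (x - (x + lam *: v)) = nrm2 (lam *: v).
  by rewrite opprD addrA subrr sub0r nrm2N.
split=> [[fx h] z|h].
  case fxE: (f x) (fP.1 x) fx h => [b| |] // _ _ h.
  rewrite xx expand; have := h z; case: (f z) (fP.1 z) => [c| |] // _.
    rewrite -!EFinD !lee_fin -/k => hz; by have := stepkK (dot v (z - x)); lra.
  by rewrite addye // !leey.
have [b fx] := prox_real fP h; split; first by rewrite fx ltry.
move=> z; have := h z; rewrite fx xx expand; case: (f z) (fP.1 z) => [c| |] // _.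
  by rewrite -!EFinD !lee_fin -/k => hz; have := stepkK (dot v (z - x)); lra.
by rewrite !leey.
Qed.

Lemma prox_lproxE u p : prox f lam u p <-> lprox_subdiff f lam p (lam^-1 *: (u - p)).
Proof.
rewrite lprox_proxE scalerA mulfV ?lt0r_neq0 // scale1r.
by rewrite addrC subrK.
Qed.

Lemma moreau_prox u p : prox f lam u p ->
  moreau f lam u = (f p + (k * nrm2 (p - u))%:E)%E.
Proof.
move=> pu; apply/eqP; rewrite eq_le moreau_le /=.
by apply: le_ereal_inf_tmp => _ [z _ <-]; exact: pu.
Qed.

Lemma moreauE u : moreau f lam u = (E u)%:E.
Proof.
have [p pu] := prox_ex u; have [b fp] := prox_real fP pu.
by rewrite /E (moreau_prox pu) fp -EFinD.
Qed.

Lemma fine_moreau_prox u p b : prox f lam u p -> f p = b%:E ->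
  E u = b + k * nrm2 (p - u).
Proof. by move=> pu fp; rewrite /E (moreau_prox pu) fp -EFinD. Qed.

Lemma fine_moreau_le u y c : f y = c%:E -> E u <= c + k * nrm2 (y - u).
Proof. by move=> fy; have := moreau_le f lam u y; rewrite fy moreauE -EFinD lee_fin. Qed.

(** The point [p] remains a competitor in the problem at [w]; expanding its quadratic around [u]
    shows [2 k (u - p)], that is [(u - p) / lam], as the candidate gradient. *)
Lemma prox_superdiff u w p : prox f lam u p ->
  E w <= E u + 2 * k * dot (u - p) (w - u) + k * nrm2 (w - u).
Proof.
move=> pu; have [b fp] := prox_real fP pu.
rewrite (fine_moreau_prox pu fp); apply: le_trans (fine_moreau_le w fp) _.
have -> : p - w = - ((u - p) + (w - u)) by apply/rowP => i; rewrite !mxE; ring.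
have -> : p - u = - (u - p) by rewrite opprB.
by rewrite !nrm2N nrm2D; lra.
Qed.

Lemma convex_moreauE U : convex_on U (moreau f lam) <->
  forall x y (t : R), U x -> U y -> 0 < t < 1 ->
    E (t *: x + (1 - t) *: y) <= t * E x + (1 - t) * E y.
Proof.
by split=> h x y t Ux Uy t01; have := h x y t Ux Uy t01;
  rewrite !moreauE -!EFinM -EFinD lee_fin.
Qed.

(** With [u_i = x_i + lam v_i], one has [lam <x1 - x2, v1 - v2> = <u1 - u2, x1 - x2> - |x1 -
    x2|^2]. *)
Lemma monotone_firm U : monotone_rel (lprox_subdiff f lam) (Wset U lam) <->
  firmly_nonexp_on (prox f lam) U.
Proof.
split=> [mono x y p q Ux Uy px qy|firm x1 v1 x2 v2].
  have W u r : U u -> Wset U lam (r, lam^-1 *: (u - r)).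
    by rewrite /Wset /= scalerA mulfV ?lt0r_neq0 // scale1r addrC subrK.
  have := mono _ _ _ _ ((prox_lproxE x p).1 px) ((prox_lproxE y q).1 qy) (W _ _ Ux) (W _ _ Uy).
  rewrite -scalerBr dotZr pmulr_rge0 ?invr_gt0 //.
  have -> : x - p - (y - q) = (x - y) - (p - q).
    by apply/rowP => i; rewrite !mxE; ring.
  by rewrite dotDr dotNr -/(nrm2 (p - q)) subr_ge0 dotC.
rewrite /Wset /= => /lprox_proxE p1 /lprox_proxE p2 U1 U2.
have := firm _ _ _ _ U1 U2 p1 p2.
have -> : x1 + lam *: v1 - (x2 + lam *: v2) = (x1 - x2) + lam *: (v1 - v2).
  by apply/rowP => i; rewrite !mxE; ring.
rewrite dotDl dotZl -/(nrm2 _) lerDl pmulr_rge0 //.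
by rewrite dotC.
Qed.

(* Minty's argument: the resolvent [prox f lam] is defined at every point of [U], so
   nothing can be added to the graph inside [W]. *)
Lemma monotone_max_monotone U : monotone_rel (lprox_subdiff f lam) (Wset U lam) ->
  max_monotone_rel (lprox_subdiff f lam) (Wset U lam).
Proof.
move=> mono; split=> // A' mono' sub x v Axv Wxv.
have [p pu] := prox_ex (x + lam *: v).
set v' := lam^-1 *: (x + lam *: v - p).
have vE : lam *: v' = x + lam *: v - p.
  by rewrite scalerA mulfV ?lt0r_neq0 // scale1r.
have Apv : lprox_subdiff f lam p v' by apply/prox_lproxE.
have Wpv : Wset U lam (p, v') by rewrite /Wset /= vE addrC subrK.
have := mono' _ _ _ _ Axv (sub _ _ Apv Wpv) Wxv Wpv.
rewrite -(pmulr_rge0 _ lam0) -dotZr scalerBr vE.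
have -> : lam *: v - (x + lam *: v - p) = - (x - p).
  by apply/rowP => i; rewrite !mxE; ring.
rewrite dotNr -/(nrm2 _) oppr_ge0 => h.
have /nrm2_eq0/subr0_eq xp : nrm2 (x - p) = 0 by apply/eqP; rewrite eq_le h nrm2_ge0.
by apply/lprox_proxE; rewrite {2}xp.
Qed.

(** The nonexpansive part is the reflected resolvent [2 P - Id]. *)
Lemma firm_averaged U : firmly_nonexp_on (prox f lam) U ->
  averaged_on 2^-1 (prox f lam) U.
Proof.
move=> firm; pose P u := projT1 (cid (prox_ex u)).
have PP u : prox f lam u (P u) by exact: projT2 (cid (prox_ex u)).
exists (fun u => 2 *: P u - u); split=> [x y Ux Uy|x Ux].
  rewrite -(@ler_pXn2r _ 2) ?nnegrE ?nrm_ge0 // -!nrm2E.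
  have -> : 2 *: P x - x - (2 *: P y - y) = 2 *: (P x - P y) - (x - y).
    by apply/rowP => i; rewrite !mxE; ring.
  rewrite [leLHS]nrm2B nrm2Z dotZl (dotC _ (x - y)).
  by have := firm _ _ _ _ Ux Uy (PP x) (PP y); lra.
have -> : (1 - 2^-1) *: x + 2^-1 *: (2 *: P x - x) = P x.
  by apply/rowP => i; rewrite !mxE; field.
(* Firm nonexpansiveness at the pair ([x], [x]) makes the proximal set a singleton. *)
apply/seteqP; split=> [p px|_ ->] //=.
have := firm _ _ _ _ Ux Ux px (PP x); rewrite subrr dotC dot0r => h.
by apply/subr0_eq/nrm2_eq0/eqP; rewrite eq_le h nrm2_ge0.
Qed.

Lemma averaged_nonexp U (alpha : R) : 0 < alpha < 1 ->
  averaged_on alpha (prox f lam) U -> nonexp_on (prox f lam) U.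
Proof.
move=> /andP[a0 a1] [N [NN TN]] x y p q Ux Uy; rewrite (TN x) // (TN y) // => -> ->.
have -> : (1 - alpha) *: x + alpha *: N x - ((1 - alpha) *: y + alpha *: N y) =
  (1 - alpha) *: (x - y) + alpha *: (N x - N y).
  by apply/rowP => i; rewrite !mxE; ring.
apply: le_trans (ler_nrmD _ _) _; rewrite !nrmZ !gtr0_norm ?subr_gt0 //.
by have := ler_wpM2l (ltW a0) (NN _ _ Ux Uy); lra.
Qed.

Lemma nonexp_dot U x y p q : nonexp_on (prox f lam) U -> U x -> U y ->
  prox f lam x p -> prox f lam y q -> dot (p - q) (x - y) <= nrm2 (x - y).
Proof.
move=> ne Ux Uy px qy; apply: le_trans (dot_le_nrm _ _) _.
by rewrite nrm2E expr2 ler_wpM2r ?nrm_ge0 // (ne x y).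
Qed.

(** This is [prox_superdiff] based at [w]. Replacing its slope by the one at [u] costs nothing
    beyond the quadratic term, because [<q - p, w - u> <= |w - u|^2]. *)
Lemma nonexp_lower U u w p : nonexp_on (prox f lam) U -> U u -> U w ->
  prox f lam u p ->
  E u + 2 * k * dot (u - p) (w - u) - k * nrm2 (w - u) <= E w.
Proof.
move=> ne Uu Uw pu; have [q qw] := prox_ex w.
have h1 := ler_wpM2l (ltW stepk_gt0) (nonexp_dot ne Uw Uu qw pu).
have := prox_superdiff u qw; rewrite -(opprB w u) dotNr nrm2N.
suff -> : dot (w - q) (w - u) = dot (u - p) (w - u) + nrm2 (w - u) - dot (q - p) (w - u).
  by move: h1; lra.
have -> : w - q = (u - p) + (w - u) - (q - p).
  by apply/rowP => i; rewrite !mxE; ring.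
by rewrite [LHS]dotDl dotNl (dotDl (u - p)).
Qed.

(* Subdividing the segment [u, w] at its midpoint halves the quadratic error. *)
Lemma nonexp_subgrad U u w p : is_convex_set U -> nonexp_on (prox f lam) U ->
  U u -> U w -> prox f lam u p -> E u + 2 * k * dot (u - p) (w - u) <= E w.
Proof.
move=> Uc ne Uu Uw pu.
apply: (le_dyadic (c := k * nrm2 (w - u))).
  by rewrite mulr_ge0 ?nrm2_ge0 // ltW // stepk_gt0.
move=> j; elim: j u w p Uu Uw pu => [|j IH] u w p Uu Uw pu.
  by rewrite expr0 divr1; have := nonexp_lower ne Uu Uw pu; lra.
set m := 2^-1 *: u + (1 - 2^-1) *: w.
have Um : U m by apply: Uc => //; lra.
have [q qm] := prox_ex m.
have mu : m - u = 2^-1 *: (w - u) by apply/rowP => i; rewrite !mxE; field.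
have wm : w - m = 2^-1 *: (w - u) by apply/rowP => i; rewrite !mxE; field.
have := IH _ _ _ Uu Um pu; have := IH _ _ _ Um Uw qm.
have h1 := ler_wpM2l (ltW stepk_gt0) (nonexp_dot ne Um Uu qm pu).
have mq : dot (m - q) (w - u) =
    dot (u - p) (w - u) + dot (m - u) (w - u) - dot (q - p) (w - u).
  have -> : m - q = (u - p) + (m - u) - (q - p).
    by apply/rowP => i; rewrite !mxE; ring.
  by rewrite [LHS]dotDl dotNl (dotDl (u - p)).
move: h1; rewrite wm mu !dotZr nrm2Z mq mu dotZl -/(nrm2 _) => h1 h2 h3.
have -> : k * nrm2 (w - u) / 2 ^+ j.+1 = 2 * (k * (2^-1 ^+ 2 * nrm2 (w - u)) / 2 ^+ j).
  by rewrite exprS; field; rewrite expf_neq0 // pnatr_eq0.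
by lra.
Qed.

(** The affine support at the intermediate point is averaged over [x] and [y]; the linear parts
    cancel. *)
Lemma subgrad_convex U : is_convex_set U ->
  (forall u w p, U u -> U w -> prox f lam u p ->
     E u + 2 * k * dot (u - p) (w - u) <= E w) ->
  convex_on U (moreau f lam).
Proof.
move=> Uc sub; apply/convex_moreauE => x y t Ux Uy t01.
have Um := Uc _ _ _ Ux Uy t01; set m := _ + _ in Um *.
case/andP: t01 => t0 t1.
have [p pm] := prox_ex m.
have hx := ler_wpM2l (ltW t0) (sub _ _ _ Um Ux pm).
have t1' : 0 <= 1 - t by lra.
have hy := ler_wpM2l t1' (sub _ _ _ Um Uy pm).
have xm : x - m = (1 - t) *: (x - y) by apply/rowP => i; rewrite !mxE; ring.
have ym : y - m = - t *: (x - y) by apply/rowP => i; rewrite !mxE; ring.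
move: hx hy; rewrite xm ym !dotZr; lra.
Qed.

Lemma nonexp_convex U : is_convex_set U -> nonexp_on (prox f lam) U ->
  convex_on U (moreau f lam).
Proof.
by move=> Uc ne; apply: subgrad_convex => // u w p; exact: nonexp_subgrad.
Qed.

(* The superdifferential bound at [u - t (w - u)], combined with convexity, forces the
   linear part to be a subgradient. *)
Lemma convex_subgrad U u w p : is_open U -> convex_on U (moreau f lam) ->
  U u -> U w -> prox f lam u p -> E u + 2 * k * dot (u - p) (w - u) <= E w.
Proof.
move=> Uo /convex_moreauE Ec Uu Uw pu; have [r [r0 Ur]] := Uo u Uu.
set h := w - u; have h1 : 0 < nrm h + 1 by have := nrm_ge0 h; lra.
apply: (@le_small _ _ _ (k * nrm2 h) (r / (nrm h + 1))).
- by rewrite divr_gt0.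
- by rewrite mulr_ge0 ?nrm2_ge0 // ltW // stepk_gt0.
move=> t /andP[t0]; rewrite ltr_pdivlMr // => tr.
have uh : u - t *: h - u = - (t *: h) by rewrite addrAC subrr sub0r.
have Ut : U (u - t *: h).
  apply: Ur; rewrite uh nrmN nrmZ gtr0_norm //; lra.
have t1 : 0 < 1 + t by lra.
set s := (1 + t)^-1.
have s01 : 0 < s < 1 by rewrite /s invr_gt0 t1 invf_lt1 //; lra.
have := Ec _ _ _ Ut Uw s01.
have -> : s *: (u - t *: h) + (1 - s) *: w = u.
  by apply/rowP => i; rewrite /s /h !mxE; field; exact: lt0r_neq0.
have := prox_superdiff (u - t *: h) pu.
rewrite uh nrm2N nrm2Z dotNr dotZr => h2 h3.
have h4 : (1 + t) * E u <= E (u - t *: h) + t * E w.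
  have := ler_wpM2l (ltW t1) h3; congr (_ <= _); rewrite /s; field; exact: lt0r_neq0.
rewrite -(ler_pM2l t0); move: h2 h4; lra.
Qed.

(** [nonexp_lower] and [prox_superdiff] enclose the first-order remainder between [-k |y - x|^2] and
    [k |y - x|^2]. *)
Lemma nonexp_gradient U : is_open U -> nonexp_on (prox f lam) U ->
  forall g, (forall u, prox f lam u (u - lam *: g u)) -> gradient_on (moreau f lam) g U.
Proof.
move=> Uo ne g gP x Ux; rewrite moreauE; split=> // e e0.
have [r [r0 Ur]] := Uo x Ux; have k0 := stepk_gt0.
exists (Num.min r (e / k)); split; first by rewrite lt_min r0 divr_gt0.
move=> y; rewrite lt_min ltr_pdivlMr // => /andP[yr ye]; rewrite moreauE; split=> //=.
have := prox_superdiff y (gP x); have := nonexp_lower ne Ux (Ur _ yr) (gP x).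
rewrite (_ : x - (x - lam *: g x) = lam *: g x); last by rewrite opprB addrC subrK.
rewrite dotZl -mulrA.
rewrite (_ : 2 * (k * (lam * dot (g x) (y - x))) = dot (g x) (y - x)); last first.
  by rewrite mulrCA stepkK.
have : k * nrm2 (y - x) <= e * nrm (y - x).
  by rewrite nrm2E expr2 mulrA ler_wpM2r ?nrm_ge0 // mulrC ltW.
rewrite ler_norml; lra.
Qed.

Lemma firm_nonexp U : firmly_nonexp_on (prox f lam) U -> nonexp_on (prox f lam) U.
Proof.
by move=> /firm_averaged; apply: averaged_nonexp; lra.
Qed.

(** Firm nonexpansiveness passes from [P] to [Id - P], which is [lam] times the gradient. *)
Lemma firm_gradient U : is_open U -> firmly_nonexp_on (prox f lam) U ->
  exists g, gradient_on (moreau f lam) g U /\ cocoercive_on lam g U.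
Proof.
move=> Uo firm; pose P u := projT1 (cid (prox_ex u)).
have PP u : prox f lam u (P u) by exact: projT2 (cid (prox_ex u)).
pose g u := lam^-1 *: (u - P u).
have gE u : lam *: g u = u - P u by rewrite scalerA mulfV ?lt0r_neq0 // scale1r.
exists g; split.
  apply: nonexp_gradient => //; first exact: firm_nonexp.
  by move=> u; rewrite gE opprB addrC subrK.
move=> x y Ux Uy; rewrite !gE.
have -> : x - P x - (y - P y) = (x - y) - (P x - P y).
  by apply/rowP => i; rewrite !mxE; ring.
have := firm _ _ _ _ Ux Uy (PP x) (PP y).
by rewrite [nrm2 (x - y - _)]nrm2B (dotDr (x - y)) (dotNr _ (P x - P y)) -/(nrm2 _); lra.
Qed.

(** A supergradient of a differentiable function, up to a quadratic error, is its gradient; this is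
    tested along the difference [w]. *)
Lemma gradient_proxE U g u p : gradient_on (moreau f lam) g U -> U u ->
  prox f lam u p -> lam *: g u = u - p.
Proof.
move=> gr Uu pu; have k0 := stepk_gt0.
set w := g u - (2 * k) *: (u - p).
suff w0 : nrm w = 0.
  have /nrm2_eq0/subr0_eq -> : nrm2 w = 0 by rewrite nrm2E w0 expr0n.
  rewrite scalerA (_ : lam * (2 * k) = 1) ?scale1r //.
  by rewrite /k; field; exact: lt0r_neq0.
apply/eqP; rewrite eq_le nrm_ge0 andbT leNgt; apply/negP => w_gt0.
have [_ /(_ (nrm w / 3)) []] := gr u Uu; first by lra.
move=> d [d0 gd].
(* The step stays inside the ball of radius [d], and each of the two errors is at most a third of
   [s * nrm2 w], which they would together have to dominate. *)
set s := Num.min (3 * k)^-1 (d / (2 * nrm w)).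
have s0 : 0 < s by rewrite lt_min invr_gt0 mulr_gt0 //= divr_gt0 // mulr_gt0.
have sk : s * (3 * k) <= 1.
  by rewrite -ler_pdivlMr ?mulr_gt0 // div1r ge_min lexx.
have sd : s * (2 * nrm w) <= d.
  by rewrite -ler_pdivlMr ?mulr_gt0 // ge_min lexx orbT.
have uw : u + s *: w - u = s *: w by rewrite addrAC subrr add0r.
have := gd (u + s *: w); rewrite uw nrmZ gtr0_norm // => /(_ _) [|_]; first by lra.
rewrite ler_norml => /andP[h1 _].
have := prox_superdiff (u + s *: w) pu; rewrite uw => h2.
have : s * nrm2 w <= nrm w / 3 * (s * nrm w) + k * nrm2 (s *: w).
  have -> : nrm2 w = dot (g u) w - 2 * k * dot (u - p) w.
    by rewrite {1}/w /nrm2 dotDl dotNl dotZl.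
  by move: h1 h2; rewrite !dotZr -/(E _) -/(E u); lra.
rewrite nrm2Z nrm2E -subr_ge0.
have -> : nrm w / 3 * (s * nrm w) + k * (s ^+ 2 * nrm w ^+ 2) - s * nrm w ^+ 2 =
   (s * nrm w ^+ 2) * ((s * (3 * k) - 2) / 3) by field.
by rewrite pmulr_rge0 ?mulr_gt0 // ?exprn_gt0 //; lra.
Qed.

Lemma cocoercive_firm U g : gradient_on (moreau f lam) g U -> cocoercive_on lam g U ->
  firmly_nonexp_on (prox f lam) U.
Proof.
move=> gr co x y p q Ux Uy px qy; have := co x y Ux Uy.
rewrite (gradient_proxE gr Ux px) (gradient_proxE gr Uy qy).
have -> : x - p - (y - q) = (x - y) - (p - q).
  by apply/rowP => i; rewrite !mxE; ring.
by rewrite [nrm2 (x - y - _)]nrm2B (dotDr (x - y)) (dotNr _ (p - q)) -/(nrm2 (x - y)); lra.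
Qed.

End MoreauEnvelope.

(** * Subgradients of convex functions and suprema of affine functions *)

Section Subgradients.
Set Implicit Arguments.
Unset Strict Implicit.
Variables (R : realType) (n : nat).
Implicit Types (f phi : 'rV[R]_n -> \bar R) (x y p q v w : 'rV[R]_n).

Lemma frechet_limiting f x v : frechet_subdiff f x v -> limiting_subdiff f x v.
Proof.
move=> [fx fv]; split=> //; exists (fun=> x), (fun=> v); split=> // e e0.
exists 0%N => j _; rewrite !subrr nrm0; do 2!split=> //.
by move: fx => /fineK <-; rewrite !lte_fin /=; lra.
Qed.

Lemma quad_minorant_frechet f x v (k b : R) : f x = b%:E -> 0 <= k ->
  (forall y, ((b + dot v (y - x) - k * nrm2 (y - x))%:E <= f y)%E) ->
  frechet_subdiff f x v.
Proof.
move=> fx k0 h; split; first by rewrite fx.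
move=> e e0; have k1 : 0 < k + 1 by lra.
exists (e / (k + 1)); split; first by rewrite divr_gt0.
move=> y; rewrite ltr_pdivlMr // => ye; apply: le_trans (h y).
rewrite fx -EFinD lee_fin.
suff : k * nrm2 (y - x) <= e * nrm (y - x) by lra.
rewrite nrm2E expr2 mulrA ler_wpM2r ?nrm_ge0 //.
by have := nrm_ge0 (y - x); lra.
Qed.

Lemma lprox_limiting f (lam : R) x v : (forall x, f x != -oo%E) -> 0 < lam ->
  lprox_subdiff f lam x v -> limiting_subdiff f x v.
Proof.
move=> fN lam0 [fx h]; apply: frechet_limiting.
case fxE: (f x) (fN x) fx h => [b| |] // _ _ h.
apply: (quad_minorant_frechet (k := (2 * lam)^-1) fxE).
  by rewrite invr_ge0 mulr_ge0 // ltW.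
by move=> y; have := h y; rewrite -EFinD addrA.
Qed.

(** The first-order inequality is used at a point of the segment close to [x]; convexity carries it
    to [y] after division by [t]. *)
Lemma convex_frechet_subgrad phi x v y :
  (forall x, phi x != -oo%E) -> convex_on [set: 'rV[R]_n] phi ->
  frechet_subdiff phi x v -> (phi x + (dot v (y - x))%:E <= phi y)%E.
Proof.
move=> phiN phic [/fineK phix] fr; set a := fine (phi x) in phix.
case phiy: (phi y) (phiN y) => [b| |] // _; last by rewrite leey.
rewrite -phix in fr *; rewrite -EFinD lee_fin.
apply: (@le_small _ _ _ (nrm (y - x)) 1) => // [|e /andP[e0 _]]; first exact: nrm_ge0.
have [d [d0 frd]] := fr e e0.
have h1 : 0 < nrm (y - x) + 1 by have := nrm_ge0 (y - x); lra.
set t := Num.min 2^-1 (d / (nrm (y - x) + 1)).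
have t0 : 0 < t by rewrite lt_min divr_gt0 // invr_gt0 ltr0n.
have t1 : t <= 2^-1 by rewrite ge_min lexx.
have td : t * (nrm (y - x) + 1) <= d.
  by rewrite -ler_pdivlMr // ge_min lexx orbT.
have tx : t *: y + (1 - t) *: x - x = t *: (y - x).
  by apply/rowP => i; rewrite !mxE; ring.
have := frd (t *: y + (1 - t) *: x); rewrite tx nrmZ gtr0_norm // => /(_ _) h.
have t01 : 0 < t < 1 by lra.
have := le_trans (h ltac:(lra)) (phic y x t I I t01).
rewrite -phix phiy -!EFinM -!EFinD lee_fin dotZr => h2.
by rewrite -(ler_pM2l t0); lra.
Qed.

Lemma convex_limiting_subgrad phi x v y :
  (forall x, phi x != -oo%E) -> convex_on [set: 'rV[R]_n] phi ->
  limiting_subdiff phi x v -> (phi x + (dot v (y - x))%:E <= phi y)%E.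
Proof.
move=> phiN phic [/fineK <-] [xs [vs [fr lim]]]; set a := fine (phi x) in lim *.
case phiy: (phi y) (phiN y) => [b| |] // _; last by rewrite leey.
rewrite -EFinD lee_fin.
have yx0 := nrm_ge0 (y - x); have v0 := nrm_ge0 v.
apply: (@le_small _ _ _ (2 + nrm (y - x) + nrm v) 1) => // [|e /andP[e0 e1]].
  by lra.
have [N /(_ N (leqnn N)) [xN [vN [aN _]]]] := lim e e0.
have := convex_frechet_subgrad y phiN phic (fr N).
case: (phi (xs N)) aN => [c| |] //=; last by rewrite phiy.
rewrite lte_fin => ac; rewrite phiy -EFinD lee_fin.
(* The three error terms and the gap in value add up to at most [e * (2 + nrm (y - x) + nrm v)],
   where [e < 1] bounds the product of two small factors. *)
have -> : dot (vs N) (y - xs N) = dot v (y - x) + dot (vs N - v) (y - x)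
    - dot v (xs N - x) - dot (vs N - v) (xs N - x).
  by rewrite !dotE; ring.
have h1 := dot_geN_nrm (vs N - v) (y - x).
have h2 := dot_le_nrm v (xs N - x).
have h3 := dot_le_nrm (vs N - v) (xs N - x).
have h4 := ler_wpM2r yx0 (ltW vN).
have h5 := ler_wpM2l v0 (ltW xN).
have h6 : nrm (vs N - v) * nrm (xs N - x) <= e * 1.
  by apply: ler_pM; rewrite ?nrm_ge0 //; lra.
lra.
Qed.

Lemma subgrad_monotone phi p q v w (b c : R) : phi p = b%:E -> phi q = c%:E ->
  (phi p + (dot v (q - p))%:E <= phi q)%E ->
  (phi q + (dot w (p - q))%:E <= phi p)%E -> 0 <= dot (p - q) (v - w).
Proof.
move=> -> ->; rewrite -!EFinD !lee_fin -(opprB p q) dotNr.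
by rewrite (dotC (p - q)) dotDl dotNl; lra.
Qed.

(** A pair holds the value at the origin and the slope of an affine function. *)
Definition affine_sup (A : set (R * 'rV[R]_n)) x : \bar R :=
  ereal_sup [set (c.1 + dot c.2 x)%:E | c in A].

Lemma affine_sup_ge A c x : A c -> ((c.1 + dot c.2 x)%:E <= affine_sup A x)%E.
Proof. by move=> Ac; apply: ereal_sup_ubound; exists c. Qed.

Lemma affine_sup_le A x (M : \bar R) :
  (forall c, A c -> ((c.1 + dot c.2 x)%:E <= M)%E) -> (affine_sup A x <= M)%E.
Proof. by move=> h; apply: ge_ereal_sup => _ [c Ac <-]; exact: h. Qed.

Lemma affine_sup_notNy A c x : A c -> affine_sup A x != -oo%E.
Proof.
by move=> /(affine_sup_ge x); case: (affine_sup A x).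
Qed.

Lemma affine_sup_lsc A : lsc_fun (affine_sup A).
Proof.
move=> x t /ereal_sup_gt[_ [c Ac <-]]; rewrite lte_fin => tc.
have c1 : 0 < nrm c.2 + 1 by have := nrm_ge0 c.2; lra.
exists ((c.1 + dot c.2 x - t) / (nrm c.2 + 1)); split.
  by rewrite divr_gt0 // subr_gt0.
move=> y; rewrite ltr_pdivlMr // => yx.
apply: lt_le_trans (affine_sup_ge y Ac); rewrite lte_fin.
have := dot_geN_nrm c.2 (y - x); have := nrm_ge0 (y - x).
by rewrite dotDr dotNr; lra.
Qed.

Lemma affine_sup_convex A : convex_on [set: 'rV[R]_n] (affine_sup A).
Proof.
move=> x y t _ _ /andP[t0 t1]; apply: affine_sup_le => c Ac.
have -> : (c.1 + dot c.2 (t *: x + (1 - t) *: y))%:E =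
  (t%:E * (c.1 + dot c.2 x)%:E + (1 - t)%:E * (c.1 + dot c.2 y)%:E)%E.
  by rewrite -!EFinM -EFinD dotDr !dotZr; congr EFin; ring.
apply: leeD; apply: lee_wpmul2l; rewrite ?affine_sup_ge // lee_fin; lra.
Qed.

End Subgradients.

(** * Variational convexity and convexity of the envelope *)

Section VariationalConvexity.
Set Implicit Arguments.
Unset Strict Implicit.
Variables (R : realType) (n : nat) (f : 'rV[R]_n -> \bar R) (xb vb : 'rV[R]_n).
Variables (a lam1 lam eps : R).
Hypothesis fP : proper_fun f.
Hypothesis flsc : lsc_fun f.
Hypothesis fa : f xb = a%:E.
Hypothesis growth :
  forall y, ((a + dot vb (y - xb) - (2 * lam1)^-1 * nrm2 (y - xb))%:E <= f y)%E.
Hypothesis eps0 : 0 < eps.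
Hypothesis regular :
  forall x v, limiting_subdiff f x v -> nrm (v - vb) < eps ->
    nrm (x - xb) < eps -> (f x < (a + eps)%:E)%E ->
    forall y, nrm (y - xb) < eps ->
      (f x + (dot v (y - x) - (2 * lam1)^-1 * nrm2 (y - x))%:E <= f y)%E.
Hypothesis lam_bd : 0 < lam < lam1.

Let k := (2 * lam)^-1.
Let k1 := (2 * lam1)^-1.
Let ub := xb + lam *: vb.
Let lam0 : 0 < lam := lam_gt0 lam_bd.
Let prox_ex := prox_exists fP flsc fa growth lam_bd.
Let prox_loc := prox_localization fP fa growth lam_bd.

Lemma variationally_convex_firm : variationally_convex f xb vb ->
  exists d : R, 0 < d /\ firmly_nonexp_on (prox f lam) (oball ub d).
Proof.
move=> [U [V [phi [e [_ [_ [[rU [rU0 HU]] [[rV [rV0 HV]]]]]]]]]].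
move=> [phiN [_ [phic [_ [e0 gph]]]]].
have [|d [d0 loc]] := prox_loc (e := Num.min rU (Num.min rV e)).
  by rewrite !lt_min rU0 rV0.
exists d; split=> //; apply/(monotone_firm fP lam0) => x1 v1 x2 v2 A1 A2 W1 W2.
(* Localization puts these pairs in the part of the graph of the subdifferential of [f] shared with
   [phi], whose subgradients are global. *)
suff in_gph x v : lprox_subdiff f lam x v -> Wset (oball ub d) lam (x, v) ->
    exists b : R, phi x = b%:E /\
      forall y, (phi x + (dot v (y - x))%:E <= phi y)%E.
  have [b [p1 s1]] := in_gph _ _ A1 W1; have [c [p2 s2]] := in_gph _ _ A2 W2.
  exact: subgrad_monotone p1 p2 (s1 x2) (s2 x1).
move=> A W; have Px := (lprox_proxE fP lam0 x v).1 A.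
have [] := loc _ _ W Px.
rewrite addrAC subrr add0r scalerA mulVf ?lt0r_neq0 // scale1r.
rewrite !lt_min => /andP[xU _] /and3P[_ vV _] fx.
have fxe : (f x < f xb + e%:E)%E.
  apply: lt_le_trans fx _; rewrite fa -EFinD lee_fin lerD2l.
  by rewrite !ge_min lexx !orbT.
have [[gph1 _] _] := gph x v.
have [|_ [_ lphi]] := gph1.
  split; first by split=> //; exact: HU.
  by split; [exact: HV | exact: lprox_limiting fP.1 lam0 A].
have [b phix] := limiting_fin lphi.
by exists b; split=> // y; exact: convex_limiting_subgrad.
Qed.

(* Prox-regularity gives the subgradient inequality near [xb] only; away from [xb] it
   follows from the strict gap between the curvatures [1/lam] and [1/lam1]. *)
Lemma local_subgrad_lprox : exists d : R, 0 < d /\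
  forall x v, limiting_subdiff f x v -> nrm (x - xb) < d -> nrm (v - vb) < d ->
    (f x < (a + d)%:E)%E -> lprox_subdiff f lam x v.
Proof.
have kk : 0 < k - k1 by rewrite subr_gt0 (k1_lt lam_bd).
have k0 : 0 < k := k_gt0 lam_bd.
have v0 := nrm_ge0 vb; have eps2 : 0 < eps ^+ 2 by rewrite exprn_gt0.
(* Outside the [eps]-ball, with [h = y - xb], the errors total [d (2 + |vb| + (1 + 2k) |h|)]. As
   [|h| >= eps], this is at most [d D |h|^2], hence at most [(k - k1) |h|^2]. *)
set D := (2 + nrm vb) / eps ^+ 2 + (1 + 2 * k) / eps.
have D0 : 0 < D by rewrite addr_gt0 // divr_gt0 //; lra.
set d := Num.min 1 (Num.min eps ((k - k1) / D)).
have d0 : 0 < d by rewrite !lt_min ltr01 eps0 divr_gt0.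
have d1 : d <= 1 by rewrite ge_min lexx.
have de : d <= eps by rewrite !ge_min lexx orbT.
have dD : d * D <= k - k1 by rewrite -ler_pdivlMr // !ge_min lexx !orbT.
exists d; split=> // x v fv xx vv fx.
have [b fb] := limiting_fin fv; split; first by rewrite fb ltry.
move=> y; rewrite -/k; case: (ltP (nrm (y - xb)) eps) => ye.
  have := regular fv (lt_le_trans vv de) (lt_le_trans xx de) _ ye.
  rewrite fb -EFinD => /(_ _) h; apply: le_trans (h _); last first.
    by rewrite -fb; apply: lt_le_trans fx _; rewrite lee_fin; lra.
  rewrite lee_fin -/k1.
  by have := mulr_ge0 (ltW kk) (nrm2_ge0 (y - x)); lra.
apply: le_trans (growth y); rewrite fb -EFinD lee_fin -/k1.
rewrite fb lte_fin in fx.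
have -> : y - x = (y - xb) - (x - xb) by apply/rowP => i; rewrite !mxE; ring.
have -> : v = vb + (v - vb) by rewrite addrC subrK.
move: (y - xb) (x - xb) (v - vb) ye xx vv => h z w ye xx vv.
rewrite nrm2B (dotDl vb) !(dotDr h) !dotNr.
have h0 := nrm_ge0 h; have d0' := ltW d0.
have e1 : dot w h <= d * nrm h.
  by apply: le_trans (dot_le_nrm _ _) _; rewrite ler_wpM2r // ltW.
have e2 : - dot vb z <= d * nrm vb.
  have := dot_geN_nrm vb z; have := ler_wpM2l v0 (ltW xx); lra.
have e3 : - dot w z <= d.
  have := dot_geN_nrm w z.
  have : nrm w * nrm z <= d * 1 by apply: ler_pM; rewrite ?nrm_ge0 //; lra.
  lra.
have e4 : k * dot h z <= k * (d * nrm h).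
  rewrite ler_wpM2l //; first exact: ltW.
  by apply: le_trans (dot_le_nrm _ _) _; rewrite mulrC ler_wpM2r // ltW.
have e5 : d * (2 + nrm vb + (1 + 2 * k) * nrm h) <= d * (D * nrm2 h).
  rewrite ler_wpM2l // /D [leRHS]mulrDl lerD //.
    rewrite mulrAC ler_pdivlMr // ler_wpM2l //; first by lra.
    by rewrite nrm2E ler_pXn2r ?nnegrE // ltW.
  rewrite mulrAC ler_pdivlMr // nrm2E expr2 -mulrA ler_wpM2l //; first by lra.
  by rewrite ler_wpM2l.
have e6 := ler_wpM2r (nrm2_ge0 h) dD.
have e7 := mulr_ge0 (ltW k0) (nrm2_ge0 z).
lra.
Qed.

(* [e_lam f] is compared at the points [u] and [y + lam v], where [v = (u - p) / lam]. *)
Lemma convex_moreau_subgrad (U : set 'rV[R]_n) : is_open U -> U ub ->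
  convex_on U (moreau f lam) ->
  exists r s : R, 0 < r /\ 0 < s /\
    forall u p y, nrm (u - ub) < s -> prox f lam u p -> nrm (y - xb) < r ->
      nrm (p - xb) < r /\ (f p + (dot (lam^-1 *: (u - p)) (y - p))%:E <= f y)%E.
Proof.
move=> Uo Uub Ec; have [r0 [r0_gt0 Ur]] := Uo _ Uub.
have l1 : 0 < 1 + lam by rewrite addr_gt0.
have e_gt0 : 0 < r0 / (1 + lam) by rewrite divr_gt0.
have [d [d0 loc]] := prox_loc e_gt0.
(* With this radius, [|y - xb| + lam |v - vb| < r0], so [y + lam v] stays in [U]. *)
exists (r0 / (1 + lam)), (Num.min r0 d); split=> //.
split; first by rewrite lt_min r0_gt0.
move=> u p y; rewrite lt_min => /andP[ur ud] pu yr.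
have [pr vr _] := loc u p ud pu; split=> //.
have [b fp] := prox_real fP pu; rewrite fp.
case fy: (f y) (fP.1 y) => [c| |] // _; last by rewrite leey.
rewrite -EFinD lee_fin; set v := lam^-1 *: (u - p) in vr *.
have vE : lam *: v = u - p by rewrite scalerA mulfV ?lt0r_neq0 // scale1r.
set w := y + lam *: v.
have Uw : U w.
  apply: Ur; have -> : w - ub = (y - xb) + lam *: (v - vb).
    by apply/rowP => i; rewrite /w /ub !mxE; ring.
  apply: le_lt_trans (ler_nrmD _ _) _; rewrite nrmZ gtr0_norm //.
  move: yr vr; rewrite !ltr_pdivlMr // => yr vr.
  rewrite -(ltr_pM2r l1); have := ltr_pM2l lam0 (nrm (v - vb) * (1 + lam)) r0.
  by rewrite vr => h; lra.
have := convex_subgrad fP lam0 prox_ex Uo Ec (Ur _ ur) Uw pu.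
rewrite (fine_moreau_prox pu fp).
have := fine_moreau_le fP prox_ex w fy.
have -> : y - w = p - u by rewrite /w vE; apply/rowP => i; rewrite !mxE; ring.
have -> : w - u = y - p by rewrite /w vE; apply/rowP => i; rewrite !mxE; ring.
rewrite -vE dotZl -/k.
have := stepkK lam0 (dot v (y - p)); rewrite -/k; lra.
Qed.

Lemma convex_moreau_variationally_convex (U : set 'rV[R]_n) : is_open U -> U ub ->
  convex_on U (moreau f lam) -> variationally_convex f xb vb.
Proof.
move=> Uo Uub Ec.
have [r [s [r0 [s0 sub]]]] := convex_moreau_subgrad Uo Uub Ec.
have [d [d0 ext]] := local_subgrad_lprox.
have [|t [t0 loc]] := prox_loc (e := Num.min r d); first by rewrite lt_min r0.
have l1 : 0 < 1 + lam by rewrite addr_gt0.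
(* The last entry keeps [x + lam v] where both [sub] and [loc] apply. *)
set q := Num.min (Num.min r d) (Num.min s t / (1 + lam)).
have q0 : 0 < q by rewrite !lt_min r0 d0 divr_gt0 // lt_min s0.
have qr : q <= r by rewrite !ge_min lexx.
have qd : q <= d by rewrite !ge_min lexx orbT.
have near x v : nrm (x - xb) < q -> nrm (v - vb) < q ->
    nrm (x + lam *: v - ub) < Num.min s t.
  move=> xq vq; have -> : x + lam *: v - ub = (x - xb) + lam *: (v - vb).
    by apply/rowP => i; rewrite /ub !mxE; ring.
  apply: le_lt_trans (ler_nrmD _ _) _; rewrite nrmZ gtr0_norm //.
  have : q * (1 + lam) <= Num.min s t by rewrite -ler_pdivlMr // ge_min lexx orbT.
  by move: vq; rewrite -(ltr_pM2l lam0); lra.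
pose slope u p := lam^-1 *: (u - p) : 'rV[R]_n.
pose A : set (R * 'rV[R]_n) := [set c | exists u p,
  [/\ nrm (u - ub) < s, prox f lam u p &
      c = (fine (f p) - dot (slope u p) p, slope u p)]].
set phi := affine_sup A.
have phi_ge u p y : nrm (u - ub) < s -> prox f lam u p ->
    (f p + (dot (slope u p) (y - p))%:E <= phi y)%E.
  move=> us pu; have [b fp] := prox_real fP pu.
  apply: le_trans (affine_sup_ge (c := (b - dot (slope u p) p, slope u p)) y _).
    by rewrite fp -EFinD lee_fin /= dotDr dotNr; lra.
  by exists u, p; rewrite fp.
have phi_le y : nrm (y - xb) < r -> (phi y <= f y)%E.
  move=> yr; apply: affine_sup_le => _ [u [p [us pu ->]]] /=.
  have [_] := sub u p y us pu yr; have [b fp] := prox_real fP pu.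
  rewrite fp /= -EFinD; congr (_ <= _)%E; rewrite dotDr dotNr; congr EFin; ring.
have phi_prox u p : nrm (u - ub) < s -> prox f lam u p -> phi p = f p.
  move=> us pu; have [pr _] := sub u p xb us pu ltac:(by rewrite subrr nrm0).
  apply/eqP; rewrite eq_le phi_le //=.
  by have := phi_ge u p p us pu; rewrite subrr dot0r adde0.
have ub_s : nrm (ub - ub) < s by rewrite subrr nrm0.
have phiN x : phi x != -oo%E.
  by have [p pu] := prox_ex ub; apply: affine_sup_notNy; exists ub, p.
have phic : convex_on [set: 'rV[R]_n] phi by exact: affine_sup_convex.
(* A nearby subgradient of [f] is a [lam]-proximal one, so [x] is the proximal point of [x + lam v]
   and [v] is one of the slopes defining [phi]. *)
have to_phi x v : oball xb q x -> (f x < f xb + d%:E)%E -> oball vb q v ->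
    limiting_subdiff f x v -> limiting_subdiff phi x v /\ f x = phi x.
  move=> xq fx vq fv.
  have /(lprox_proxE fP lam0) px : lprox_subdiff f lam x v.
    by apply: ext => //; [exact: lt_le_trans qd | exact: lt_le_trans qd
      | rewrite EFinD -fa].
  have := near x v xq vq; rewrite lt_min => /andP[us _].
  have phix := phi_prox _ _ us px; split=> //.
  have [b fb] := prox_real fP px; apply: frechet_limiting.
  apply: (quad_minorant_frechet (k := 0) (b := b)) => //; first by rewrite phix.
  move=> y; have := phi_ge _ _ y us px.
  rewrite /slope addrAC subrr add0r scalerA mulVf ?lt0r_neq0 // scale1r.
  by rewrite fb -EFinD mul0r subr0.
(* Minty: the proximal point [p] of [x + lam v] carries a subgradient of [phi], and monotonicity
   yields [|x - p|^2 <= 0]. The bound on [f x] then comes from [loc]. *)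
have from_phi x v : oball xb q x -> oball vb q v -> limiting_subdiff phi x v ->
    (f x < f xb + d%:E)%E /\ limiting_subdiff f x v.
  move=> xq vq lphi; have := near x v xq vq; rewrite lt_min => /andP[us ut].
  set u := x + lam *: v in us ut.
  have [p pu] := prox_ex u.
  have [b fp] := prox_real fP pu; have [c phix] := limiting_fin lphi.
  have phip := phi_prox _ _ us pu.
  have sp : (phi p + (dot (slope u p) (x - p))%:E <= phi x)%E.
    by rewrite phip; exact: phi_ge.
  have := subgrad_monotone phix (etrans phip fp)
    (convex_limiting_subgrad p phiN phic lphi) sp.
  have -> : v - slope u p = - (lam^-1 *: (x - p)).
    by apply/rowP => i; rewrite /slope /u !mxE; field; exact: lt0r_neq0.
  rewrite dotNr dotZr oppr_ge0 pmulr_rle0 ?invr_gt0 // => h.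
  have xp : x = p.
    by apply/subr0_eq/nrm2_eq0/eqP; rewrite eq_le h nrm2_ge0.
  rewrite -{}xp in pu.
  have [_ _ fx] := loc _ _ ut pu; split.
    apply: lt_le_trans fx _; rewrite fa -EFinD lee_fin lerD2l.
    by rewrite ge_min lexx orbT.
  by apply: (lprox_limiting fP.1 lam0); apply/(lprox_proxE fP lam0).
exists (oball xb q), (oball vb q), phi, d.
split; first exact: oball_convex.
split; first exact: oball_convex.
split; first exact: oball_nbhd.
split; first exact: oball_nbhd.
do 2!split=> //; first exact: affine_sup_lsc.
split=> //; split; first by move=> x xq; apply: phi_le; exact: lt_le_trans qr.
split=> // x v; split; last by move=> [[xq fx] [vq fv]]; exact: (to_phi x v _ _ _ _).2.
split=> [[[xq fx] [vq fv]]|[xq [vq fv]]].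
  by split=> //; split=> //; exact: (to_phi x v _ _ _ _).1.
by have [fx lf] := from_phi x v xq vq fv.
Qed.

End VariationalConvexity.

(** * Choice of the neighborhoods and the cycle of implications *)

Theorem mainTheorem1 (R : realType) (n : nat) (f : 'rV[R]_n -> \bar R)
    (xb vb : 'rV[R]_n) :
  proper_fun f -> lsc_fun f -> prox_bounded f -> (0 < prox_threshold f)%E ->
  limiting_subdiff f xb vb -> prox_regular f xb vb ->
  exists lb : R, 0 < lb /\ (lb%:E <= prox_threshold f)%E /\
    (forall lam : R, 0 < lam < lb -> prox f lam (xb + lam *: vb) = [set xb]) /\
    exists U : R -> set 'rV[R]_n,
      (forall lam : R, 0 < lam < lb ->
         is_open (U lam) /\ is_convex_set (U lam) /\ U lam (xb + lam *: vb)) /\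
      [<-> variationally_convex f xb vb;
           forall lam : R, 0 < lam < lb ->
             monotone_rel (lprox_subdiff f lam) (Wset (U lam) lam);
           forall lam : R, 0 < lam < lb ->
             max_monotone_rel (lprox_subdiff f lam) (Wset (U lam) lam);
           forall lam : R, 0 < lam < lb -> firmly_nonexp_on (prox f lam) (U lam);
           forall lam : R, 0 < lam < lb ->
             exists alpha : R, 0 < alpha < 1 /\ averaged_on alpha (prox f lam) (U lam);
           forall lam : R, 0 < lam < lb -> nonexp_on (prox f lam) (U lam);
           forall lam : R, 0 < lam < lb -> convex_on (U lam) (moreau f lam);
           exists lam : R, 0 < lam < lb /\ convex_on (U lam) (moreau f lam);
           forall lam : R, 0 < lam < lb ->
             exists g : 'rV[R]_n -> 'rV[R]_n,
               gradient_on (moreau f lam) g (U lam) /\ cocoercive_on lam g (U lam)].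
Proof.
move=> fP flsc pb _ subd reg; have [a fa] := limiting_fin subd.
have [lam1 [eps [lam1_gt0 lam1_le eps0 growth regular]]] :=
  prox_regular_growth pb subd reg fa.
exists lam1; do 2!split=> //.
split; first by move=> lam bd; exact: (prox_center fP flsc fa growth bd).
(* Excluded middle: the radius comes from variational convexity when it holds, and is 1 by
   default. *)
have /choice [r rP] : forall lam, exists d : R, 0 < d /\
    (variationally_convex f xb vb -> 0 < lam < lam1 ->
     firmly_nonexp_on (prox f lam) (oball (xb + lam *: vb) d)).
  move=> lam; have [[vc bd]|nvc] :=
    pselect (variationally_convex f xb vb /\ 0 < lam < lam1).
    have [d [d0 firm]] := variationally_convex_firm fP fa growth bd vc.
    by exists d.
  by exists 1; split=> // vc bd; case: nvc.
pose U lam := oball (xb + lam *: vb) (r lam); exists U.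
have Uo lam : is_open (U lam) by exact: oball_open.
have Uc lam : is_convex_set (U lam) by exact: oball_convex.
have Ux lam : U lam (xb + lam *: vb) by apply: oball_center; have [] := rP lam.
have l0 lam : 0 < lam < lam1 -> 0 < lam by case/andP.
have pe lam : 0 < lam < lam1 -> forall u, exists p, prox f lam u p.
  by move=> bd; exact: (prox_exists fP flsc fa growth bd).
have convex_vc lam : 0 < lam < lam1 -> convex_on (U lam) (moreau f lam) ->
    variationally_convex f xb vb.
  move=> bd; exact: (convex_moreau_variationally_convex fP flsc fa growth eps0 regular bd
    (Uo lam) (Ux lam)).
have firm_convex lam : 0 < lam < lam1 -> firmly_nonexp_on (prox f lam) (U lam) ->
    convex_on (U lam) (moreau f lam).
  move=> bd firm; apply: (nonexp_convex fP (l0 _ bd) (pe _ bd)) => //.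
  exact: (firm_nonexp (pe _ bd)).
have half : 0 < lam1 / 2 < lam1 by lra.
split; first by move=> lam _; split.
tfae.
- move=> vc lam bd; apply/(monotone_firm fP (l0 _ bd)).
  by have [_] := rP lam; exact.
- by move=> mono lam bd; apply: (monotone_max_monotone fP (l0 _ bd) (pe _ bd)); exact: mono.
- by move=> maxm lam bd; apply/(monotone_firm fP (l0 _ bd)); have [] := maxm lam bd.
- move=> firm lam bd; exists 2^-1; split; first by lra.
  by apply: (firm_averaged (pe _ bd)); exact: firm.
- by move=> av lam bd; have [alpha [a01 /averaged_nonexp]] := av lam bd; exact.
- move=> ne lam bd; apply: (nonexp_convex fP (l0 _ bd) (pe _ bd)) => //; exact: ne.
- by move=> conv; exists (lam1 / 2); split=> //; exact: conv.
(* Convexity for the single [mu] gives variational convexity, which does not depend on the parameter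
   and so reaches every [lam]. *)
- move=> [mu [mubd /(convex_vc mu mubd) vc]] lam bd.
  apply: (firm_gradient fP (l0 _ bd) (pe _ bd)) => //.
  by have [_] := rP lam; exact.
- move=> /(_ _ half) [g [gr co]]; apply: convex_vc (half) _; apply: firm_convex (half) _.
  exact: (cocoercive_firm fP (l0 _ half) (pe _ half) gr co).
Qed.
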